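(* Let $H$ be a real Hilbert space, let $U$ be a weakly mixing orthogonal transformation of $H$, and let $\xi \in H$ be a star-cyclic unit vector for $U$ (that is, $\|\xi\|=1$ and the linear span of $\{U^n\xi:\ n \in \mathbf{Z}\}$ is dense in $H$). Then there is another orthogonal transformation $V$ of $H$, conjugate to $U$, such that: (i$^\prime$) $\xi$ is also star-cyclic for $V$ and satisfies $\langle U^i\xi,\xi\rangle = \langle V^i\xi,\xi\rangle$ for every $i\in\mathbf{Z}$; and (ii$^\prime$) the averages \[a_n := \frac{1}{n}\sum_{i=0}^{n-1} \langle U^i\xi,V^i\xi\rangle \qquad (n\ge 1)\] satisfy $\limsup_{n\to\infty} a_n = 1$ and $\liminf_{n\to\infty} a_n = -1$.
   Context: An orthogonal transformation of a real Hilbert space $H$ is a surjective linear isometry $H\to H$. Two orthogonal transformations $U$ and $V$ of $H$ are conjugate if there is an orthogonal transformation $W$ of $H$ such that $V = WUW^{-1}$. An orthogonal transformation $U$ of $H$ is weakly mixing if $\frac{1}{n}\sum_{i=0}^{n-1}|\langle U^i\eta,\zeta\rangle|\to 0$ as $n\to\infty$ for all $\eta,\zeta\in H$. A vector $\xi$ is star-cyclic for $V$ if the linear span of $\{V^n\xi : n\in\mathbf{Z}\}$ is dense in $H$. *)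

(* Defs.v *)
From HB Require Import structures.
From mathcomp Require Import all_boot all_order all_algebra.
From mathcomp Require Import all_classical all_reals all_analysis.

Set Implicit Arguments.
Unset Strict Implicit.
Unset Printing Implicit Defensive.

Import Order.TTheory GRing.Theory Num.Theory.
Import numFieldNormedType.Exports.

Local Open Scope classical_set_scope.
Local Open Scope ring_scope.

(* A real Hilbert space is a complete normed module H over R together with a
   symmetric, bilinear, positive definite form that induces its norm. *)
Definition induces_norm (R : realType) (H : completeNormedModType R)
    (dot : {dot H for @idfun R}) : Prop :=
  forall x : H, `|x| = Num.sqrt (dot x x).

Definition orthogonal_transformation (R : realType)
    (H : completeNormedModType R) (U : H -> H) : Prop :=
  [/\ linear U,
      forall x y : H, `|U x - U y| = `|x - y| &
      set_surj [set: H] [set: H] U].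

(* The two-sided inverse of U when U is bijective, as is the case for
   orthogonal transformations; see orthogonalK and orthogonalKV. *)
Definition inv_map (R : realType) (H : completeNormedModType R)
    (U : H -> H) : H -> H :=
  'pinv_(fun=> 0) [set: H] U.

Lemma orthogonalK (R : realType) (H : completeNormedModType R) (U : H -> H) :
  orthogonal_transformation U -> cancel U (inv_map U).
Proof.
move=> [_ isoU _] x.
have injU : {in [set: H] &, injective U}.
  move=> y z _ _ Uyz; apply/eqP.
  by rewrite -subr_eq0 -normr_eq0 -isoU Uyz subrr normr0.
by rewrite /inv_map pinvKV ?in_setT.
Qed.

Lemma orthogonalKV (R : realType) (H : completeNormedModType R) (U : H -> H) :
  orthogonal_transformation U -> cancel (inv_map U) U.
Proof. by move=> [_ _ sU] x; rewrite /inv_map (surjpK _ sU) ?in_setT. Qed.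

(* U^i for an integer i; Negz n stands for -(n + 1) *)
Definition zpow (R : realType) (H : completeNormedModType R)
    (U : H -> H) (i : int) : H -> H :=
  match i with
  | Posz n => iter n U
  | Negz n => iter n.+1 (inv_map U)
  end.

Definition conjugate (R : realType) (H : completeNormedModType R)
    (U V : H -> H) : Prop :=
  exists2 W : H -> H,
    orthogonal_transformation W & V = W \o U \o inv_map W.

(* In the averages below the term of index n = 0 is 0, as 0^-1 = 0. *)
Definition weakly_mixing (R : realType) (H : completeNormedModType R)
    (dot : {dot H for @idfun R}) (U : H -> H) : Prop :=
  forall eta zeta : H,
    (n%:R^-1 * \sum_(0 <= i < n) `|dot (iter i U eta) zeta|)
      @[n --> \oo] --> (0 : R).

Definition linear_span (R : realType) (H : completeNormedModType R)
    (A : set H) : set H :=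
  [set x | exists (m : nat) (c : 'I_m -> R) (v : 'I_m -> H),
     (forall k, A (v k)) /\ x = \sum_(k < m) c k *: v k].

Definition star_cyclic (R : realType) (H : completeNormedModType R)
    (U : H -> H) (xi : H) : Prop :=
  dense (linear_span (range (fun i : int => zpow U i xi))).

Definition averages (R : realType) (H : completeNormedModType R)
    (dot : {dot H for @idfun R}) (U V : H -> H) (xi : H) (n : nat) : R :=
  n%:R^-1 * \sum_(0 <= i < n) dot (iter i U xi) (iter i V xi).

(* Main.v *)
(** Take [V = W U W^-1], where [W] is a reflection [1 - 2 P] fixing [xi]; since
    [V^i xi = W (U^i xi)], condition (i') is automatic. Let [e] be the Gram-Schmidt
    sequence of [xi, U xi, U^2 xi, ...] and let [P] be the projection onto the closed
    span of the [e j] with [j] in a set [S] not containing [0]. Then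
    [<U^i xi, V^i xi> = 1 - 2 \sum_(j <= i, j in S) <U^i xi, e j>^2], where the sum
    over all [j <= i] is [1]. By weak mixing the part of the sum over any bounded
    set of [j] is negligible on average, so alternating sufficiently long blocks
    of indices outside and inside [S] drives the averages towards [1] and [-1]
    in turn. *)

Require Import Defs.
From HB Require Import structures.
From mathcomp Require Import all_boot all_order all_algebra.
From mathcomp Require Import all_classical all_reals all_analysis.
From mathcomp Require Import ring lra.

Set Implicit Arguments.
Unset Strict Implicit.
Unset Printing Implicit Defensive.

Import Order.TTheory GRing.Theory Num.Theory.
Import numFieldNormedType.Exports.

Local Open Scope classical_set_scope.
Local Open Scope ring_scope.

(** * Norms under orthogonal transformations *)

Lemma orthogonal_transformation_norm (R : realType) (H : completeNormedModType R)
    (W : H -> H) x :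
  orthogonal_transformation W -> `|W x| = `|x|.
Proof.
move=> [linW isoW _].
have W0 : W 0 = 0.
  by have := linW (-1) 0 0; rewrite scaler0 addr0 scaleN1r addNr.
by rewrite -[W x]subr0 -W0 isoW subr0.
Qed.

Lemma iter_orthogonal_norm (R : realType) (H : completeNormedModType R)
    (W : H -> H) n x :
  orthogonal_transformation W -> `|iter n W x| = `|x|.
Proof. by move=> oW; elim: n => //= n <-; exact: orthogonal_transformation_norm. Qed.

(** * Inner product identities in a real Hilbert space *)

Section RealInnerProduct.
Context (R : realType) (H : completeNormedModType R).
Variable dot : {dot H for @idfun R}.
Implicit Types (x y z : H) (a : R).

Lemma rdotC x y : dot x y = dot y x.
Proof. by rewrite (hermC dot) expr0 mul1r. Qed.

Lemma rdotZl a x y : dot (a *: x) y = a * dot x y.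
Proof. exact: (linearZl_LR dot). Qed.

Lemma rdotZr a x y : dot x (a *: y) = a * dot x y.
Proof. by rewrite rdotC rdotZl rdotC. Qed.

Lemma rdotDl x y z : dot (x + y) z = dot x z + dot y z.
Proof. exact: (linearDl dot). Qed.

Lemma rdotBl x y z : dot (x - y) z = dot x z - dot y z.
Proof. exact: (linearBl dot). Qed.

Lemma rdotBr x y z : dot z (x - y) = dot z x - dot z y.
Proof. exact: (linearBr dot). Qed.

Lemma rdot0l x : dot 0 x = 0.
Proof. exact: (linear0l dot). Qed.

Lemma rdot0r x : dot x 0 = 0.
Proof. by rewrite rdotC rdot0l. Qed.

Lemma rdot_suml (r : seq nat) (P : pred nat) (F : nat -> H) x :
  dot (\sum_(i <- r | P i) F i) x = \sum_(i <- r | P i) dot (F i) x.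
Proof. exact: (linear_sumlz dot). Qed.

Lemma rdot_ge0 x : 0 <= dot x x.
Proof.
have [->|x0] := eqVneq x 0; first by rewrite rdot0l.
exact/ltW/neq0_dnorm_gt0.
Qed.

Hypothesis dot_norm : induces_norm dot.

Lemma rdot_sqr_norm x : dot x x = `|x| ^+ 2.
Proof. by rewrite dot_norm sqr_sqrtr // rdot_ge0. Qed.

Lemma rdot_polarization x y :
  dot x y = 2^-1 * (`|x| ^+ 2 + `|y| ^+ 2 - `|x - y| ^+ 2).
Proof. rewrite -!rdot_sqr_norm rdotBl !rdotBr (rdotC y x); by field. Qed.

Lemma orthogonal_transformation_dot (W : H -> H) :
  orthogonal_transformation W -> forall x y, dot (W x) (W y) = dot x y.
Proof.
move=> oW x y; have [_ isoW _] := oW.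
by rewrite !rdot_polarization isoW !(orthogonal_transformation_norm _ oW).
Qed.

(* Zero vectors are allowed, so that Gram-Schmidt applies to linearly dependent
   sequences and discarding indices amounts to replacing vectors by 0. *)
Definition partial_orthonormal (e : nat -> H) : Prop :=
  (forall i j, i != j -> dot (e i) (e j) = 0) /\
  (forall i, dot (e i) (e i) *: e i = e i).

Definition fourier_term (e : nat -> H) x (i : nat) : H := dot x (e i) *: e i.

Lemma partial_orthonormal_restrict (e : nat -> H) (S : pred nat) :
  partial_orthonormal e -> partial_orthonormal (fun i => if S i then e i else 0).
Proof.
move=> [oe ne]; split=> [i j ij|i].
  by case: ifP => _; case: ifP => _; rewrite ?rdot0l ?rdot0r // oe.
by case: ifP => _; rewrite ?ne ?scaler0.
Qed.

(** * Fourier series and reflections for a partially orthonormal sequence *)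

Section PartialOrthonormal.
Variable e : nat -> H.
Hypothesis oe : partial_orthonormal e.

Lemma dot_fourier_basis x i j :
  dot (fourier_term e x i) (e j) = if i == j then dot x (e j) else 0.
Proof.
rewrite rdotZl; case: eqVneq => [->|ij]; last by rewrite (oe.1 _ _ ij) mulr0.
(* The identity [dot (e j) (e j) *: e j = e j] absorbs the extra factor, whether [e j] is zero or a
   unit vector. *)
by rewrite -{4}(oe.2 j) rdotZr mulrC.
Qed.

Lemma dot_fourier_sum x m n y :
  dot (\sum_(m <= i < n) fourier_term e x i) y =
  \sum_(m <= i < n) dot x (e i) * dot y (e i).
Proof. by rewrite rdot_suml; apply: eq_bigr => i _; rewrite rdotZl (rdotC y). Qed.

Lemma dot_fourier_sum_basis x m n j :
  dot (\sum_(m <= i < n) fourier_term e x i) (e j) =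
  if (m <= j < n)%N then dot x (e j) else 0.
Proof.
rewrite rdot_suml (eq_bigr (fun i => if i == j then dot x (e j) else 0)).
  by rewrite -big_mkcond big_nat1_eq.
by move=> i _; rewrite dot_fourier_basis.
Qed.

Lemma dnorm_fourier_sum x m n :
  dot (\sum_(m <= i < n) fourier_term e x i)
      (\sum_(m <= i < n) fourier_term e x i) =
  \sum_(m <= i < n) dot x (e i) ^+ 2.
Proof.
rewrite dot_fourier_sum big_nat [RHS]big_nat; apply: eq_bigr => i mn.
by rewrite dot_fourier_sum_basis mn.
Qed.

(** Expand the nonnegative squared norm of [x] minus its partial Fourier sum. *)
Lemma bessel x n : \sum_(0 <= i < n) dot x (e i) ^+ 2 <= dot x x.
Proof.
have := rdot_ge0 (x - \sum_(0 <= i < n) fourier_term e x i).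
rewrite rdotBl !rdotBr dnorm_fourier_sum (rdotC x) dot_fourier_sum.
by under eq_bigr do rewrite -expr2; lra.
Qed.

Lemma sqr_coef_le_dnorm x i : dot x (e i) ^+ 2 <= dot x x.
Proof.
apply: le_trans (bessel x i.+1); rewrite big_nat_recr //= lerDr.
by apply: sumr_ge0 => j _; exact: sqr_ge0.
Qed.

(** The squared norm of a block of the series is a block of the series of squared coefficients,
    which is bounded by [bessel]; completeness of [H] concludes. *)
Lemma is_cvg_fourier x : cvgn (series (fourier_term e x)).
Proof.
apply/cauchy_cvgP/cauchy_seriesP => eps eps0.
have cvg2 : cvgn (series (fun i => dot x (e i) ^+ 2)).
  apply: nondecreasing_is_cvgn.
    by apply: nondecreasing_series => i _ _; exact: sqr_ge0.
  by exists (dot x x) => _ [n _ <-]; exact: bessel.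
have /cauchy_cvgP/cauchy_seriesP/(_ _ (exprn_gt0 2 eps0)) := cvg2.
apply: filterS => mn; rewrite -dnorm_fourier_sum rdot_sqr_norm normrX normr_id.
by rewrite ltr_pXn2r ?nnegrE // ltW.
Qed.

Definition reflection x : H := x - 2 *: limn (series (fourier_term e x)).

(** Finite truncations of [reflection]: linearity, isometry and involutivity are direct computations
    here and then pass to the limit. *)
Definition partial_reflection n x : H :=
  x - 2 *: \sum_(0 <= i < n) fourier_term e x i.

Lemma cvg_partial_reflection x :
  (partial_reflection n x) @[n --> \oo] --> reflection x.
Proof.
apply: cvgB; first exact: cvg_cst.
apply: cvgZl_tmp; exact: is_cvg_fourier.
Qed.

Lemma reflection_unique x y :
  (partial_reflection n x) @[n --> \oo] --> y -> reflection x = y.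
Proof.
by move=> xy; apply: cvg_unique (@cvg_partial_reflection x) xy; exact: norm_hausdorff.
Qed.

Lemma partial_reflection_linear n : linear (partial_reflection n).
Proof.
move=> a x y; rewrite /partial_reflection.
have -> : \sum_(0 <= i < n) fourier_term e (a *: x + y) i =
    a *: (\sum_(0 <= i < n) fourier_term e x i) +
    \sum_(0 <= i < n) fourier_term e y i.
  rewrite scaler_sumr -big_split; apply: eq_bigr => i _ /=.
  by rewrite /fourier_term rdotDl rdotZl scalerDl scalerA.
by rewrite !scalerDr scalerN !scalerA (mulrC 2 a) opprD addrACA.
Qed.

Lemma norm_partial_reflection n x : `|partial_reflection n x| = `|x|.
Proof.
rewrite !dot_norm /partial_reflection rdotBl !rdotBr !(rdotZl, rdotZr).
rewrite dnorm_fourier_sum (rdotC x) dot_fourier_sum.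
under eq_bigr do rewrite -expr2.
by congr Num.sqrt; ring.
Qed.

Lemma partial_reflectionK n : involutive (partial_reflection n).
Proof.
move=> x; set y := partial_reflection n x.
have coefy i : (i < n)%N -> dot y (e i) = - dot x (e i).
  by move=> ni; rewrite rdotBl rdotZl dot_fourier_sum_basis ni; ring.
have -> : partial_reflection n y = y + 2 *: \sum_(0 <= i < n) fourier_term e x i.
  congr (_ + _); rewrite -scalerN -sumrN; congr (_ *: _).
  rewrite big_nat [RHS]big_nat; apply: eq_bigr => i ni.
  by rewrite /fourier_term coefy // scaleNr opprK.
by rewrite subrK.
Qed.

Lemma reflection_linear : linear reflection.
Proof.
move=> a x y; apply: reflection_unique.
under eq_fun do rewrite partial_reflection_linear.
by apply: cvgD; [apply: cvgZl_tmp|]; exact: cvg_partial_reflection.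
Qed.

Lemma norm_reflection x : `|reflection x| = `|x|.
Proof.
apply: (@cvg_unique _ (@norm_hausdorff _ R^o) (`|partial_reflection n x| @[n --> \oo])).
  by apply: cvg_norm; exact: cvg_partial_reflection.
by apply: cvg_near_cst; apply: nearW => n; exact: norm_partial_reflection.
Qed.

Lemma reflectionB x y : reflection (x - y) = reflection x - reflection y.
Proof.
by rewrite addrC -scaleN1r reflection_linear scaleN1r addrC.
Qed.

Lemma reflectionK : involutive reflection.
Proof.
move=> x; apply: reflection_unique; apply/cvgrPdist_lt => eps eps0.
have /cvgrPdist_lt/(_ _ eps0) := @cvg_partial_reflection x.
apply: filterS => n; congr (_ < _).
(* Applying the isometric involution [partial_reflection n] inside the norm turns the distance from
   [reflection x] to [partial_reflection n x] into the required one, so no double limit arises. *)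
rewrite -(norm_partial_reflection n) [RHS]distrC; congr `|_|.
rewrite [_ - partial_reflection n x]addrC -scaleN1r partial_reflection_linear.
by rewrite scaleN1r partial_reflectionK addrC.
Qed.

Lemma reflection_orthogonal : orthogonal_transformation reflection.
Proof.
split; first exact: reflection_linear.
- by move=> x y; rewrite -reflectionB norm_reflection.
- by move=> y _; exists (reflection y); rewrite ?reflectionK.
Qed.

Lemma reflection_finite x m : (forall k, (m <= k)%N -> dot x (e k) = 0) ->
  reflection x = partial_reflection m x.
Proof.
move=> x0; apply: reflection_unique; apply: cvg_near_cst.
exists m => // n /= mn.
have tail0 : \sum_(m <= i < n) fourier_term e x i = 0.
  rewrite big_nat big1 // => i /andP[mi _].
  by rewrite /fourier_term x0 // scale0r.
by rewrite /partial_reflection (big_cat_nat (leq0n m) mn) /= tail0 addr0.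
Qed.

End PartialOrthonormal.

Lemma partial_orthonormal_coef0 (e : nat -> H) x n :
  partial_orthonormal e -> x = \sum_(0 <= i < n) fourier_term e x i ->
  forall k, (n <= k)%N -> dot x (e k) = 0.
Proof. by move=> oe -> k nk; rewrite dot_fourier_sum_basis // ltnNge nk andbF. Qed.

(** The restricted family vanishes off [S] and [x] has no coefficients from [n] on, so the
    reflection is a finite sum in which only the indices of [S] below [n] count. *)
Lemma dot_reflection (e : nat -> H) (S : pred nat) x n :
  partial_orthonormal e -> x = \sum_(0 <= i < n) fourier_term e x i ->
  dot x (reflection (fun i => if S i then e i else 0) x) =
  dot x x - 2 * \sum_(0 <= i < n | S i) dot x (e i) ^+ 2.
Proof.
move=> oe xE; rewrite (@reflection_finite _ _ _ n); last 2 first.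
- exact: partial_orthonormal_restrict.
- move=> k nk; case: ifP => _; rewrite ?rdot0r //.
  exact: partial_orthonormal_coef0 oe xE k nk.
rewrite rdotBr rdotZr (rdotC x (\sum_(_ <= _ < _) _)) dot_fourier_sum.
rewrite [in RHS]big_mkcond; congr (_ - _ * _); apply: eq_bigr => i _.
by case: ifP => _; rewrite -expr2 // rdot0r expr0n.
Qed.

(** * Gram-Schmidt for possibly dependent sequences *)

Section GramSchmidt.
Variable x : nat -> H.

(** Zero is sent to zero, so a vector dependent on its predecessors yields a zero vector. *)
Definition normalize y : H := `|y|^-1 *: y.

(** The component of [y] orthogonal to the first [n] Gram-Schmidt vectors, by successive
    subtraction; [u] is the vector named [gram_schmidt m] below. *)
Fixpoint residual n y : H :=
  if n is m.+1 then
    let u := normalize (residual m (x m)) in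
    residual m y - dot (residual m y) u *: u
  else y.

Definition gram_schmidt n : H := normalize (residual n (x n)).

Lemma normalizeE y : dot y (normalize y) *: normalize y = y.
Proof.
have [->|y0] := eqVneq y 0; first by rewrite /normalize !scaler0.
rewrite rdotZr rdot_sqr_norm scalerA expr2.
have ny0 : `|y| != 0 by rewrite normr_eq0.
by rewrite mulrA mulVf // mul1r mulfV // scale1r.
Qed.

Lemma dnorm_normalize y : dot (normalize y) (normalize y) *: normalize y = normalize y.
Proof. by rewrite {1}/normalize rdotZl -scalerA normalizeE. Qed.

(** The last subtraction removes the component along the newest vector and keeps orthogonality to
    the older ones, since [u] is itself a multiple of a residual. *)
Lemma dot_residual_gram_schmidt n y j :
  (j < n)%N -> dot (residual n y) (gram_schmidt j) = 0.
Proof.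
elim: n y => // n IHn y; rewrite ltnS leq_eqVlt /= -/(gram_schmidt n).
rewrite rdotBl rdotZl => /orP[/eqP->|jn].
  by rewrite mulrC -rdotZr dnorm_normalize subrr.
by rewrite IHn // rdotZl IHn // !mulr0 subrr.
Qed.

Lemma gram_schmidt_orthonormal : partial_orthonormal gram_schmidt.
Proof.
split=> [i j|i]; last exact: dnorm_normalize.
wlog ji : i j / (j < i)%N => [th|_].
  by case: (ltngtP i j) => // ij _; [rewrite rdotC|]; apply: th => //; rewrite gtn_eqF.
by rewrite rdotZl dot_residual_gram_schmidt // mulr0.
Qed.

Lemma residualE n y :
  residual n y = y - \sum_(0 <= i < n) fourier_term gram_schmidt y i.
Proof.
elim: n => [|n IHn]; first by rewrite big_nil subr0.
rewrite big_nat_recr //= opprD addrA -IHn /fourier_term; congr (_ - _ *: _).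
(* Earlier Fourier terms are orthogonal to the vector of index [n], so the residual and [y] have the
   same coefficient there. *)
rewrite {1}IHn rdotBl dot_fourier_sum_basis ?ltnn ?subr0 //.
exact: gram_schmidt_orthonormal.
Qed.

(** The residual of [x n] at stage [n.+1] is zero: the last step subtracts from [residual n (x n)]
    its component along its own normalization. *)
Lemma gram_schmidt_expansion n :
  x n = \sum_(0 <= i < n.+1) fourier_term gram_schmidt (x n) i.
Proof.
by apply/eqP; rewrite -subr_eq0 -residualE /= normalizeE subrr.
Qed.

End GramSchmidt.

End RealInnerProduct.

(** * Averages, their upper limits, and oscillating index sets *)

Section Averages.
Context (R : realType).
Implicit Types (u s : nat -> R).

Definition average u n : R := n%:R^-1 * \sum_(0 <= i < n) u i.

Lemma average_le u s n : (forall i, (i < n)%N -> u i <= s i) -> average u n <= average s n.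
Proof.
move=> us; rewrite ler_wpM2l ?invr_ge0 //.
by rewrite big_nat [leRHS]big_nat; apply: ler_sum => i /us.
Qed.

Lemma average_cst (c : R) n : (0 < n)%N -> average (fun=> c) n = c.
Proof.
move=> n0; rewrite /average sumr_const_nat subn0 -[c *+ n]mulr_natl mulrA mulVf ?mul1r //.
by rewrite pnatr_eq0 -lt0n.
Qed.

Lemma average_affine (c d : R) u n : (0 < n)%N ->
  average (fun i => c + d * u i) n = c + d * average u n.
Proof.
move=> n0; rewrite /average big_split mulrDr -/(average (fun=> c) n) average_cst //.
by rewrite -mulr_sumr mulrCA.
Qed.

Lemma averageN u n : average (fun i => - u i) n = - average u n.
Proof. by rewrite /average sumrN mulrN. Qed.

Lemma limn_esup_eq u (l : R) :
  (forall n, u n <= l) ->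
  (forall eps : R, 0 < eps -> forall N, exists2 n, (N <= n)%N & l - eps <= u n) ->
  limn_esup (fun n => (u n)%:E) = l%:E.
Proof.
move=> ul lu; rewrite limn_esup_lim; apply/eqP; rewrite eq_le; apply/andP; split.
  apply: lime_le; first exact: is_cvg_esups.
  apply: nearW => N; apply: ge_ereal_sup => _ [n _ <-]; by rewrite lee_fin.
apply: lime_ge; first exact: is_cvg_esups.
apply: nearW => N; apply/lee_subgt0Pr => eps eps0.
have [n Nn le_n] := lu _ eps0 N.
apply: (@le_trans _ _ (u n)%:E); first by rewrite lee_fin.
by apply: ereal_sup_ubound; exists n.
Qed.

(** Meant for two uses: the averages with [s] the mass inside [S], and their negatives with [s] the
    mass outside [S]. *)
Lemma limn_esup_average u s : (forall i, u i <= 1) ->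
  (forall i, u i = 1 - 2 * s i) ->
  (forall eps : R, 0 < eps -> forall N, exists n,
    [/\ (N <= n)%N, (0 < n)%N & average s n <= eps]) ->
  limn_esup (fun n => (average u n)%:E) = 1%:E.
Proof.
move=> u1 us small; apply: limn_esup_eq => [[|n]|eps eps0 N].
- by rewrite /average big_nil mulr0.
- by rewrite -(@average_cst 1 n.+1) //; exact: average_le.
(* Half of [eps], because [s] enters [u] with factor 2. *)
have [n [Nn n0 sn]] := small _ (divr_gt0 eps0 (ltr0Sn R 1)) N.
exists n => //; rewrite (_ : u = fun i => 1 + (- 2) * s i).
  by rewrite average_affine //; lra.
by apply/funext => i; rewrite us mulNr.
Qed.

(* [S] is a union of every other block of a fast growing sequence of times [N k]:
   at time [N k.+1] the mass of the indices below [N k] is negligible on average,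
   and all remaining indices lie in the block from [N k] to [N k.+1]. *)
Lemma oscillating_index_set (c : nat -> nat -> R) :
  (forall i j, 0 <= c i j) ->
  (forall M, average (fun i => \sum_(0 <= j < M) c i j) n @[n --> \oo] --> (0 : R)) ->
  exists2 S : pred nat, ~~ S 0 &
    forall b : bool, forall eps : R, 0 < eps -> forall N, exists n,
      [/\ (N <= n)%N, (0 < n)%N &
          average (fun i => \sum_(0 <= j < i.+1 | S j == b) c i j) n <= eps].
Proof.
move=> c0 cvg0.
have next (kM : nat * nat) : exists n, (kM.2 < n)%N /\
    average (fun i => \sum_(0 <= j < kM.2) c i j) n <= kM.1.+1%:R^-1.
  have k0 : 0 < kM.1.+1%:R^-1 :> R by rewrite invr_gt0.
  have /cvgrPdist_le/(_ _ k0)[m _ mP] := cvg0 kM.2.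
  exists (maxn m kM.2.+1); split; first by rewrite leq_max ltnSn orbT.
  have /mP /= := leq_maxl m kM.2.+1.
  by rewrite sub0r normrN; exact/le_trans/ler_norm.
have [g gP] := choice next.
(* Starting at 1 keeps the index 0 out of every block, hence out of [S]. *)
pose N := fix N k := if k is k'.+1 then g (k', N k') else 1%N.
have Nlt k : (N k < N k.+1)%N by have [] := gP (k, N k).
have Nmono : {homo N : k l / (k <= l)%N}.
  by apply: homo_leq => // [m n p|k]; [exact: leq_trans|exact: ltnW].
have Ngt k : (k < N k)%N.
  by elim: k => // k IHk; exact: leq_ltn_trans (Nlt k).
pose S : pred nat := fun j => `[< exists k, (N k.*2 <= j < N k.*2.+1)%N >].
have tail eps : 0 < eps -> forall m, exists k, (m <= k)%N /\ k.+1%:R^-1 <= eps :> R.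
  move=> eps0 m; exists (maxn m (Num.truncn eps^-1)); rewrite leq_maxl; split=> //.
  rewrite -[leRHS]invrK lef_pV2 ?posrE ?invr_gt0 //.
  apply/ltW/(lt_le_trans (truncnS_gt _)).
  by rewrite ler_nat ltnS leq_maxr.
(* The block from [N k] to [N k.+1] lies in [S] exactly when [k] is even, so an index with
   [S j = odd k] cannot lie in it. *)
have low k j : (j < N k.+1)%N -> S j = odd k -> (j < N k)%N.
  move=> jk Sj; rewrite ltnNge; apply/negP => kj.
  move: Sj; case: (boolP (odd k)) => ok; last first.
    move/negbT/asboolPn; apply; exists k./2.
    by rewrite even_halfK // kj.
  move/asboolP => [l /andP[lj jl]].
  have lk : (l.*2 <= k)%N.
    by rewrite leqNgt; apply/negP => /Nmono/leq_trans/(_ lj); rewrite leqNgt jk.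
  have kl : (k <= l.*2)%N.
    by rewrite leqNgt; apply/negP => /Nmono/leq_trans/(_ kj); rewrite leqNgt jl.
  have kE : k = l.*2 by apply/eqP; rewrite eqn_leq kl.
  by move: ok; rewrite kE odd_double.
exists S.
  by apply/asboolPn => -[k /andP[+ _]]; rewrite leqNgt (leq_ltn_trans _ (Ngt _)).
move=> b eps eps0 m; have [k [mk keps]] := tail _ eps0 m.
(* The parity of [l] is [b], so by [low] the last block before time [N l.+1] contains no index with
   [S j = b]. *)
pose l := (k.*2 + b)%N.
have kl : (k <= l)%N by rewrite /l -addnn -addnA leq_addr.
have lb : odd l = b by rewrite /l oddD odd_double; case: (b).
exists (N l.+1); split.
- exact: leq_trans mk (leq_trans kl (ltnW (ltn_trans (ltnSn _) (Ngt _)))).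
- exact: leq_ltn_trans (Ngt _).
apply: le_trans (keps); apply: (@le_trans _ _ l.+1%:R^-1); last first.
  by rewrite lef_pV2 ?posrE // ler_nat.
have [_ /=] := gP (l, N l); apply: le_trans; apply: average_le => i il.
(* Both inner sums are extended to indices below [N l.+1], to be compared term by term. *)
rewrite [leLHS](big_nat_widen _ _ (N l.+1)) //.
rewrite [leRHS](big_nat_widen _ _ (N l.+1)) ?(ltnW (Nlt l)) //.
rewrite [leLHS]big_mkcond [leRHS]big_mkcond big_nat [leRHS]big_nat.
apply: ler_sum => j /= jl; case: ifP => [/andP[/eqP Sj _]|_]; last by case: ifP.
by rewrite low // Sj lb.
Qed.

End Averages.

(** * Weak mixing against finitely many vectors *)

Section WeakMixing.
Context (R : realType) (H : completeNormedModType R).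
Variable dot : {dot H for @idfun R}.
Hypothesis dot_norm : induces_norm dot.

(** Each coefficient has absolute value at most 1, so its square is at most its absolute value,
    whose average tends to 0; finitely many such limits add up. *)
Lemma weakly_mixing_finite_rank (U : H -> H) (xi : H) (e : nat -> H) M :
  orthogonal_transformation U -> weakly_mixing dot U -> `|xi| = 1 ->
  partial_orthonormal dot e ->
  average (fun i => \sum_(0 <= j < M) dot (iter i U xi) (e j) ^+ 2) n
    @[n --> \oo] --> (0 : R).
Proof.
move=> oU wmU xi1 oe.
have bound : (\sum_(0 <= j < M) average (fun i => `|dot (iter i U xi) (e j)|) n)
    @[n --> \oo] --> (0 : R).
  elim: M => [|M IHM].
    by under eq_fun do rewrite big_nil; exact: cvg_cst.
  under eq_fun do rewrite big_nat_recr //=.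
  by have := cvgD IHM (wmU xi (e M)); rewrite addr0; exact.
apply: (squeeze_cvgr _ (cvg_cst 0) bound); apply: nearW => n; apply/andP; split.
  rewrite mulr_ge0 ?invr_ge0 // sumr_ge0 // => i _.
  by rewrite sumr_ge0 // => j _; exact: sqr_ge0.
rewrite -mulr_sumr exchange_big ler_wpM2l ?invr_ge0 //.
apply: ler_sum => i _; apply: ler_sum => j _.
set d := dot _ _.
have d1 : d ^+ 2 <= 1.
  apply: le_trans (sqr_coef_le_dnorm oe _ _) _.
  by rewrite (rdot_sqr_norm dot_norm) iter_orthogonal_norm // xi1 expr1n.
rewrite -real_normK ?num_real // expr2 ler_piMr // -(@expr_le1 _ 2) //.
by rewrite real_normK ?num_real.
Qed.

End WeakMixing.

(** * Conjugation by an orthogonal involution *)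

Section Conjugation.
Context (R : realType) (H : completeNormedModType R).

Lemma orthogonal_transformation_inv_eq (U : H -> H) y z :
  orthogonal_transformation U -> U z = y -> inv_map U y = z.
Proof. by move=> oU <-; exact: orthogonalK. Qed.

Lemma orthogonal_transformation_comp (U V : H -> H) :
  orthogonal_transformation U -> orthogonal_transformation V ->
  orthogonal_transformation (U \o V).
Proof.
move=> oU oV; have [linU isoU _] := oU; have [linV isoV _] := oV; split.
- by move=> a x y /=; rewrite linV linU.
- by move=> x y /=; rewrite isoU isoV.
- move=> y _; exists (inv_map V (inv_map U y)) => //=.
  by rewrite !orthogonalKV.
Qed.

Lemma orthogonal_transformation_continuous (U : H -> H) :
  orthogonal_transformation U -> continuous U.
Proof.
move=> [_ isoU _] x; apply/cvgrPdist_lt => eps eps0.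
near=> y; rewrite isoU; near: y.
exact: cvgr_dist_lt.
Unshelve. all: by end_near. Qed.

Variables (W U : H -> H).
Hypotheses (orthW : orthogonal_transformation W) (orthU : orthogonal_transformation U)
  (WK : involutive W).

Lemma orthogonal_involution_inv : inv_map W = W.
Proof.
by apply/funext => x; apply: orthogonal_transformation_inv_eq (WK x).
Qed.

Let V := W \o U \o W.

Lemma orthogonal_conjugate : orthogonal_transformation V.
Proof. by do 2![apply: orthogonal_transformation_comp => //]. Qed.

Lemma zpow_conjugate (i : int) x : zpow V i x = W (zpow U i (W x)).
Proof.
have iterW f n y : iter n (W \o f \o W) y = W (iter n f (W y)).
  by elim: n => [|n IHn] /=; rewrite ?IHn WK.
have invV : inv_map V = W \o inv_map U \o W.
  apply/funext => y; apply: orthogonal_transformation_inv_eq orthogonal_conjugate _.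
  by rewrite /V /= WK orthogonalKV // WK.
by case: i => n; rewrite /zpow ?invV iterW.
Qed.

(** As [W] fixes [x], it carries the span of the [U]-orbit of [x] into that of the [V]-orbit; an
    open set is met by pulling it back along the continuous [W]. *)
Lemma star_cyclic_conjugate x : W x = x -> star_cyclic U x -> star_cyclic V x.
Proof.
move=> Wx cycU O [y Oy] openO.
have openWO : open (W @^-1` O).
  apply: open_comp openO => z _; exact: orthogonal_transformation_continuous.
have [|z [Oz [m [c [v [vU zE]]]]]] := cycU _ _ openWO.
  by exists (W y); rewrite /preimage /= WK.
exists (W z); split=> //; exists m, c, (W \o v); split=> [k|].
  by have [i _ /= <-] /= := vU k; exists i; rewrite // zpow_conjugate Wx.
have [linW _ _] := orthW.
pose Wl : {linear H -> H} := HB.pack W (GRing.isLinear.Build R H H *:%R W linW).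
rewrite zE -[W]/(Wl : H -> H) linear_sum; apply: eq_bigr => k _.
by rewrite linearZ.
Qed.

End Conjugation.

Theorem mainTheorem2 (R : realType) (H : completeNormedModType R)
    (dot : {dot H for @idfun R}) (dot_norm : induces_norm dot)
    (U : H -> H) (orthU : orthogonal_transformation U)
    (wmU : weakly_mixing dot U)
    (xi : H) (xi1 : `|xi| = 1) (xi_cyc : star_cyclic U xi) :
  exists V : H -> H,
    [/\ orthogonal_transformation V,
        conjugate U V,
        star_cyclic V xi /\
        (forall i : int, dot (zpow U i xi) xi = dot (zpow V i xi) xi) &
        limn_esup (fun n => (averages dot U V xi n)%:E) = 1%:E /\
        limn_einf (fun n => (averages dot U V xi n)%:E) = (- 1)%:E].
Proof.
pose x n := iter n U xi.
have x1 n : dot (x n) (x n) = 1.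
  by rewrite (rdot_sqr_norm dot_norm) iter_orthogonal_norm // xi1 expr1n.
pose e := gram_schmidt dot x.
have oe : partial_orthonormal dot e := gram_schmidt_orthonormal dot_norm x.
have xE n : x n = \sum_(0 <= i < n.+1) fourier_term dot e (x n) i.
  exact: gram_schmidt_expansion.
have [//|M|S S0 Sosc] :=
    @oscillating_index_set R (fun i j => dot (x i) (e j) ^+ 2) _.
- by move=> i j; exact: sqr_ge0.
- exact: weakly_mixing_finite_rank.
pose f i := if S i then e i else 0.
have of_ : partial_orthonormal dot f by exact: partial_orthonormal_restrict.
pose W := reflection dot f.
have orthW : orthogonal_transformation W by exact: reflection_orthogonal.
have WK : involutive W by exact: reflectionK.
(* By [xE 0], [xi] has no coefficient on [e k] for [k > 0], and [S] omits 0, so all its coefficients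
   in [f] vanish and the truncation at 0 suffices. *)
have Wxi : W xi = xi.
  rewrite /W (@reflection_finite _ _ _ dot_norm _ of_ _ 0) => [|k _].
    by rewrite /partial_reflection big_nil scaler0 subr0.
  rewrite /f; case: ifP => [Sk|_]; last by rewrite rdot0r.
  rewrite -[xi]/(x 0); apply: (partial_orthonormal_coef0 oe (xE 0)).
  by case: k Sk => // S0'; rewrite S0' in S0.
pose s b i : R := \sum_(0 <= j < i.+1 | S j == b) dot (x i) (e j) ^+ 2.
have s0 b i : 0 <= s b i by apply: sumr_ge0 => j _; exact: sqr_ge0.
(* Parseval for the unit vector [x i], expanded in the [e j] with [j <= i]. *)
have s1 i : s true i + s false i = 1.
  rewrite -(x1 i) {1}(xE i) dot_fourier_sum (bigID (fun j => S j == true)) /=.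
  under [in RHS]eq_bigr do rewrite -expr2.
  under [X in _ = _ + X]eq_bigr do rewrite -expr2.
  by congr (_ + _); apply: eq_bigl => j; case: (S j).
have dotW i : dot (x i) (W (x i)) = 1 - 2 * s true i.
  rewrite (dot_reflection dot_norm S oe (xE i)) x1; congr (_ - _ * _).
  by apply: eq_bigl => j; case: (S j).
pose V := W \o U \o W.
have avgE : averages dot U V xi = average (fun i => dot (x i) (W (x i))).
  apply/funext => n; congr (_ * _); apply: eq_bigr => i _.
  by have := zpow_conjugate orthW orthU WK i xi; rewrite /= Wxi => ->.
exists V; split.
- exact: orthogonal_conjugate.
- by exists W => //; rewrite orthogonal_involution_inv.
- split; first exact: star_cyclic_conjugate.
  move=> i; rewrite zpow_conjugate // Wxi -{4}Wxi.
  by rewrite (orthogonal_transformation_dot dot_norm orthW).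
rewrite avgE; split.
  apply: limn_esup_average (Sosc true) => i; rewrite dotW //.
  by have := s0 true i; lra.
(* The lower limit is minus the upper limit of the negatives, and by [s1] the negated terms are
   [1 - 2 * s false i]. *)
rewrite /limn_einf -[RHS]/(- 1%:E)%E; congr (- _)%E.
rewrite [X in limn_esup X](_ : _ =
  fun n => (average (fun i => - dot (x i) (W (x i))) n)%:E); last first.
  by apply/funext => n; rewrite averageN.
apply: limn_esup_average (Sosc false) => i; rewrite dotW -/(s false i).
  by have := s0 false i; have := s1 i; lra.
by have := s1 i; lra.
Qed.
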